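(* Let $\delta\in\{1,-1,0\}$ and let $\mathbf{M}_\delta$ be a timelike Weingarten rotational surface in $\mathbb{S}^3_1$ (spherical for $\delta=1$, hyperbolic of the first kind for $\delta=-1$, parabolic for $\delta=0$), with profile curve parameterized by the principal curvature $\lambda$, whose principal curvatures satisfy $\kappa=\frac a\lambda$. Let $$\Psi_{-1}(\lambda,\delta)=\psi_0\pm c^2\int\frac{\lambda^2\,d\lambda}{\sqrt{\lambda^2+a}\,(c^2-\delta(\lambda^2+a))\sqrt{(\lambda^2+1)c^2-\delta(\lambda^2+a)}}$$ for constants $\psi_0$, $a$ and $c>0$. Then the coordinate functions of the profile curve of $\mathbf{M}_\delta$ with constant Gaussian curvature in $\mathbb{S}^3_1$, parameterized with respect to $\lambda$, are given by one of the following. 1. For $\delta=1$: (a) $y(\lambda)=\frac{c}{\sqrt{\lambda^2+a}}$, $z(\lambda)=\sqrt{1-y^2(\lambda)}\cosh\Psi_{-1}(\lambda,1)$, $w(\lambda)=\sqrt{1-y^2(\lambda)}\sinh\Psi_{-1}(\lambda,1)$ where i) $\lambda<-\sqrt{c^2-a}$ or $\lambda>\sqrt{c^2-a}$ for $c^2>\max\{1,a\}$; ii) $-\sqrt{\frac{c^2-a}{1-c^2}}<\lambda<-\sqrt{c^2-a}$ or $\sqrt{c^2-a}<\lambda<\sqrt{\frac{c^2-a}{1-c^2}}$ for $a<c^2<1$; iii) $\lambda<-\sqrt{\frac{a-c^2}{c^2-1}}$ or $\lambda>\sqrt{\frac{a-c^2}{c^2-1}}$ if $1<c^2<a$; (b)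 $y(\lambda)=\frac{c}{\sqrt{\lambda^2+a}}$, $z(\lambda)=\sqrt{y^2(\lambda)-1}\sinh\Psi_{-1}(\lambda,1)$, $w(\lambda)=\sqrt{y^2(\lambda)-1}\cosh\Psi_{-1}(\lambda,1)$ where i) $-\sqrt{c^2-a}<\lambda<\sqrt{c^2-a}$ for $0\le a<c^2$; ii) $-\sqrt{c^2-a}<\lambda<-\sqrt{-a}$ or $\sqrt{-a}<\lambda<\sqrt{c^2-a}$ for $a<0$ and $c<1$. 2. For $\delta=-1$: $w(\lambda)=\frac{c}{\sqrt{\lambda^2+a}}$, $x(\lambda)=\sqrt{1+w^2(\lambda)}\cos\Psi_{-1}(\lambda,-1)$, $y(\lambda)=\sqrt{1+w^2(\lambda)}\sin\Psi_{-1}(\lambda,-1)$ where i) $\lambda<-\sqrt{-a}$ or $\lambda>\sqrt{-a}$ for $a<0$; ii) $\lambda\in\mathbb{R}$ for $a\ge0$. 3. For $\delta=0$: $z(\lambda)=\frac{c}{\sqrt{\lambda^2+a}}$, $x(\lambda)=\Psi_{-1}(\lambda,0)z(\lambda)$, $w(\lambda)=\frac{1-x^2(\lambda)}{2z(\lambda)}$ where i) $\lambda<-\sqrt{-a}$ or $\lambda>\sqrt{-a}$ for $a<0$; ii) $\lambda\in\mathbb{R}$ for $a\ge0$.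
   Context: $\mathbb{E}^4_1$ is 4-dimensional Minkowski space with metric $\tilde g$, and $\mathbb{S}^3_1=\{\mathbf{x}\in\mathbb{E}^4_1:\tilde g(\mathbf{x},\mathbf{x})=1\}$ is de Sitter space. For $\delta=\pm1$ coordinates are used in which $\tilde g(\mathbf{x},\mathbf{y})=x_1y_1+x_2y_2+x_3y_3-x_4y_4$; for $\delta=0$, coordinates in which $\tilde g(\mathbf{x},\mathbf{y})=x_1y_1+x_2y_2+x_3y_4+x_4y_3$. Rotational surfaces $\mathbf{M}_\delta$, with $u\in J$ the arc length parameter of the profile curve $C$, $\tilde g(C',C')=\varepsilon=\pm1$, $'=d/du$: - Spherical, $\mathbf{M}_1$: $r(u,v)=(y\sin v,y\cos v,z,w)$, $v\in[0,2\pi]$, $y>0$, $y^2+z^2-w^2=1$, $y'^2+z'^2-w'^2=\varepsilon$; induced metric $\varepsilon du^2+y^2dv^2$; $z',w'$ nonzero. - Hyperbolic of the first kind, $\mathbf{M}_{-1}$: $r(u,v)=(x,y,w\sinh v,w\cosh v)$, $v\in\mathbb{R}$, $w>0$, $x^2+y^2-w^2=1$, $x'^2+y'^2-w'^2=\varepsilon$; induced metric $\varepsilon du^2+w^2dv^2$; $x',y'$ nonzero. - Parabolic, $\mathbf{M}_0$: $r(u,v)=(x,vz,z,-\tfrac12v^2z+w)$, $v\in\mathbb{R}$, $z>0$, $2zw+x^2=1$, $2z'w'+x'^2=\varepsilon$; induced metric $\varepsilon du^2+z^2dv^2$; $x',z'$ nonzero. Here $x,y,z,w$ are functions of $u$,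 and the surfaces are assumed not contained in a hyperplane of $\mathbb{E}^4_1$. The surface is spacelike if $\varepsilon=1$ and timelike if $\varepsilon=-1$. ''Parameterized with respect to $\lambda$'' means $\lambda$ replaces $u$ as parameter of the profile curve; the coordinate functions become functions of $\lambda$. Principal curvatures: with $N$ a unit normal field of the surface in $\mathbb{S}^3_1$, $\kappa=\tilde g(r_{uu},N)$ and $\lambda=\tilde g(r_{vv},N)/\tilde g(r_v,r_v)$; the eigenvalues of the shape operator are $\varepsilon\kappa,\lambda$. Convention: $\lambda$ ranges over an open interval on which the displayed expressions are real and well defined, i.e. $\lambda^2+a>0$, $c^2-\delta(\lambda^2+a)\ne0$ and $(\lambda^2+1)c^2-\delta(\lambda^2+a)>0$. The integral denotes an antiderivative in $\lambda$.
   Formalization: For δ=1 the printed list is not exhaustive: added are c²=1 with a<1 and c²=a>1 (λ≠0) in (a), and a<0 with c≥1 (same range) in (b) ii; the formulas for z and w hold up to a common sign, since (z,w)→(−z,−w) is an isometry. *)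

(* Defs.v *)
From Stdlib Require Import Reals.
From Coquelicot Require Import Coquelicot.
Open Scope R_scope.

(* The three families M_1, M_{-1}, M_0; [delta] is the corresponding index. *)
Inductive kind := spherical | hyperbolic | parabolic.

Definition delta (k : kind) : R :=
  match k with spherical => 1 | hyperbolic => -1 | parabolic => 0 end.

Definition E4 : Type := (R * R * R * R)%type.

(* Minkowski metric; for [parabolic] the third and fourth coordinates are taken
   along null vectors. *)
Definition gt (k : kind) (a b : E4) : R :=
  let '(a1, a2, a3, a4) := a in
  let '(b1, b2, b3, b4) := b in
  match k with
  | spherical | hyperbolic => a1 * b1 + a2 * b2 + a3 * b3 - a4 * b4
  | parabolic => a1 * b1 + a2 * b2 + a3 * b4 + a4 * b3
  end.

Definition Derive4 (f : R -> E4) (t : R) : E4 :=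
  (Derive (fun s => fst (fst (fst (f s)))) t,
   Derive (fun s => snd (fst (fst (f s)))) t,
   Derive (fun s => snd (fst (f s))) t,
   Derive (fun s => snd (f s)) t).

Definition is_open_interval (S : R -> Prop) : Prop :=
  exists lo hi : Rbar, Rbar_lt lo hi /\
    forall t : R, S t <-> Rbar_lt lo t /\ Rbar_lt t hi.

Definition smooth_on (S : R -> Prop) (f : R -> R) : Prop :=
  forall (n : nat) (t : R), S t -> ex_derive_n f n t.

(* Each family uses three of the four coordinate functions: [px] is unused for
   [spherical], [pz] for [hyperbolic] and [py] for [parabolic]. *)
Record profile := Profile { px : R -> R; py : R -> R; pz : R -> R; pw : R -> R }.

Definition rsurf (k : kind) (p : profile) (u v : R) : E4 :=
  match k with
  | spherical => (py p u * sin v, py p u * cos v, pz p u, pw p u)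
  | hyperbolic => (px p u, py p u, pw p u * sinh v, pw p u * cosh v)
  | parabolic => (px p u, v * pz p u, pz p u, - (1 / 2) * v ^ 2 * pz p u + pw p u)
  end.

Definition vdom (k : kind) (v : R) : Prop :=
  match k with
  | spherical => 0 <= v <= 2 * PI
  | hyperbolic | parabolic => True
  end.

(* g(r_v, r_v) = radius^2. *)
Definition radius (k : kind) (p : profile) : R -> R :=
  match k with spherical => py p | hyperbolic => pw p | parabolic => pz p end.

Definition profile_curve (k : kind) (p : profile) (u : R) : E4 := rsurf k p u 0.

Definition r_u (k : kind) (p : profile) (u v : R) : E4 :=
  Derive4 (fun s => rsurf k p s v) u.
Definition r_v (k : kind) (p : profile) (u v : R) : E4 :=
  Derive4 (fun s => rsurf k p u s) v.
Definition r_uu (k : kind) (p : profile) (u v : R) : E4 :=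
  Derive4 (fun s => r_u k p s v) u.
Definition r_vv (k : kind) (p : profile) (u v : R) : E4 :=
  Derive4 (fun s => r_v k p u s) v.

Definition in_hyperplane (k : kind) (p : profile) (J : R -> Prop) : Prop :=
  exists (h : E4) (d : R), h <> (0, 0, 0, 0) /\
    forall u v, J u -> vdom k v -> gt k h (rsurf k p u v) = d.

Definition nonzero_derivatives (k : kind) (p : profile) (u : R) : Prop :=
  match k with
  | spherical => Derive (pz p) u <> 0 /\ Derive (pw p) u <> 0
  | hyperbolic => Derive (px p) u <> 0 /\ Derive (py p) u <> 0
  | parabolic => Derive (px p) u <> 0 /\ Derive (pz p) u <> 0
  end.

(* Rotational surface in de Sitter space whose profile curve is parameterized by
   arc length, g(C', C') = eps; spacelike for eps = 1, timelike for eps = -1. *)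
Record rotational_surface (k : kind) (eps : R) (J : R -> Prop) (p : profile)
    : Prop := {
  rs_interval : is_open_interval J;
  rs_smooth : smooth_on J (px p) /\ smooth_on J (py p) /\
              smooth_on J (pz p) /\ smooth_on J (pw p);
  rs_radius : forall u, J u -> 0 < radius k p u;
  rs_desitter : forall u, J u ->
    gt k (profile_curve k p u) (profile_curve k p u) = 1;
  rs_arclength : forall u, J u ->
    gt k (Derive4 (profile_curve k p) u) (Derive4 (profile_curve k p) u) = eps;
  rs_nonzero : forall u, J u -> nonzero_derivatives k p u;
  rs_not_hyperplane : ~ in_hyperplane k p J }.

(* Tangent to de Sitter space means orthogonal to the position vector.  The
   tangent plane has causal character eps, hence g(N, N) = - eps. *)
Record unit_normal (k : kind) (eps : R) (J : R -> Prop) (p : profile)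
    (N : R -> R -> E4) : Prop := {
  un_continuous :
    continuous_on (fun q : R * R => J (fst q) /\ vdom k (snd q))
      (fun q : R * R => (N (fst q) (snd q) : R * R * R * R));
  un_desitter : forall u v, J u -> vdom k v -> gt k (N u v) (rsurf k p u v) = 0;
  un_u : forall u v, J u -> vdom k v -> gt k (N u v) (r_u k p u v) = 0;
  un_v : forall u v, J u -> vdom k v -> gt k (N u v) (r_v k p u v) = 0;
  un_unit : forall u v, J u -> vdom k v -> gt k (N u v) (N u v) = - eps }.

Definition principal_curvatures (k : kind) (J : R -> Prop) (p : profile)
    (N : R -> R -> E4) (kap lam : R -> R) : Prop :=
  forall u v, J u -> vdom k v ->
    kap u = gt k (r_uu k p u v) (N u v) /\
    lam u = gt k (r_vv k p u v) (N u v) / gt k (r_v k p u v) (r_v k p u v).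

(* [lam] is a regular change of parameter from [J] onto [L], with inverse [U]. *)
Definition change_of_parameter (J L : R -> Prop) (lam U : R -> R) : Prop :=
  (forall u, J u -> L (lam u) /\ U (lam u) = u) /\
  (forall l, L l -> J (U l) /\ lam (U l) = l) /\
  (forall u, J u -> ex_derive lam u /\ Derive lam u <> 0).

Definition reparam (p : profile) (U : R -> R) : profile :=
  Profile (fun l => px p (U l)) (fun l => py p (U l))
          (fun l => pz p (U l)) (fun l => pw p (U l)).

Definition Psi_integrand (k : kind) (a c l : R) : R :=
  l ^ 2 / (sqrt (l ^ 2 + a) * (c ^ 2 - delta k * (l ^ 2 + a))
           * sqrt ((l ^ 2 + 1) * c ^ 2 - delta k * (l ^ 2 + a))).

(* [F] is psi0 + c^2 * (antiderivative) or psi0 - c^2 * (antiderivative). *)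
Definition is_Psi (k : kind) (a c psi0 : R) (L : R -> Prop) (F : R -> R) : Prop :=
  exists (s : R) (P : R -> R), (s = 1 \/ s = -1) /\
    (forall l, L l -> is_derive P l (Psi_integrand k a c l)) /\
    (forall l, L l -> F l = psi0 + s * c ^ 2 * P l).

(* In the spherical formulas [sg] is the isometry (z, w) |-> (- z, - w), which
   preserves the family M_1, the metric and the principal curvatures. *)
Definition spherical_a (a c : R) (L : R -> Prop) (F : R -> R) (q : profile)
    : Prop :=
  exists sg : R, (sg = 1 \/ sg = -1) /\
    forall l, L l ->
      py q l = c / sqrt (l ^ 2 + a) /\
      pz q l = sg * (sqrt (1 - py q l ^ 2) * cosh (F l)) /\
      pw q l = sg * (sqrt (1 - py q l ^ 2) * sinh (F l)).

Definition spherical_b (a c : R) (L : R -> Prop) (F : R -> R) (q : profile)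
    : Prop :=
  exists sg : R, (sg = 1 \/ sg = -1) /\
    forall l, L l ->
      py q l = c / sqrt (l ^ 2 + a) /\
      pz q l = sg * (sqrt (py q l ^ 2 - 1) * sinh (F l)) /\
      pw q l = sg * (sqrt (py q l ^ 2 - 1) * cosh (F l)).

Definition hyperbolic_formulas (a c : R) (L : R -> Prop) (F : R -> R)
    (q : profile) : Prop :=
  forall l, L l ->
    pw q l = c / sqrt (l ^ 2 + a) /\
    px q l = sqrt (1 + pw q l ^ 2) * cos (F l) /\
    py q l = sqrt (1 + pw q l ^ 2) * sin (F l).

Definition parabolic_formulas (a c : R) (L : R -> Prop) (F : R -> R)
    (q : profile) : Prop :=
  forall l, L l ->
    pz q l = c / sqrt (l ^ 2 + a) /\
    px q l = F l * pz q l /\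
    pw q l = (1 - px q l ^ 2) / (2 * pz q l).

(* The last two alternatives are the boundary constants c^2 = 1 and c^2 = a,
   which do occur (e.g. c = 1, a = 0, where y = 1 / |lambda|). *)
Definition range_a (a c : R) (L : R -> Prop) : Prop :=
  (Rmax 1 a < c ^ 2 /\
   forall l, L l -> l < - sqrt (c ^ 2 - a) \/ sqrt (c ^ 2 - a) < l)
  \/
  (a < c ^ 2 < 1 /\
   forall l, L l ->
     - sqrt ((c ^ 2 - a) / (1 - c ^ 2)) < l < - sqrt (c ^ 2 - a) \/
     sqrt (c ^ 2 - a) < l < sqrt ((c ^ 2 - a) / (1 - c ^ 2)))
  \/
  (1 < c ^ 2 < a /\
   forall l, L l ->
     l < - sqrt ((a - c ^ 2) / (c ^ 2 - 1)) \/
     sqrt ((a - c ^ 2) / (c ^ 2 - 1)) < l)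
  \/
  (a < c ^ 2 /\ c ^ 2 = 1 /\
   forall l, L l -> l < - sqrt (c ^ 2 - a) \/ sqrt (c ^ 2 - a) < l)
  \/
  (1 < c ^ 2 /\ c ^ 2 = a /\ forall l, L l -> l < 0 \/ 0 < l).

(* The last alternative, a < 0 and c >= 1, does occur (e.g. a = -1, c = 2); its
   range is the same as for a < 0 and c < 1. *)
Definition range_b (a c : R) (L : R -> Prop) : Prop :=
  (0 <= a < c ^ 2 /\
   forall l, L l -> - sqrt (c ^ 2 - a) < l < sqrt (c ^ 2 - a))
  \/
  (a < 0 /\ c < 1 /\
   forall l, L l ->
     - sqrt (c ^ 2 - a) < l < - sqrt (- a) \/
     sqrt (- a) < l < sqrt (c ^ 2 - a))
  \/
  (a < 0 /\ 1 <= c /\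
   forall l, L l ->
     - sqrt (c ^ 2 - a) < l < - sqrt (- a) \/
     sqrt (- a) < l < sqrt (c ^ 2 - a)).

(* For a >= 0 every real lambda is allowed. *)
Definition range_c (a : R) (L : R -> Prop) : Prop :=
  (a < 0 /\ forall l, L l -> l < - sqrt (- a) \/ sqrt (- a) < l)
  \/ 0 <= a.

Definition profile_classification (k : kind) (a c : R) (L : R -> Prop)
    (F : R -> R) (q : profile) : Prop :=
  match k with
  | spherical =>
      (spherical_a a c L F q /\ range_a a c L) \/
      (spherical_b a c L F q /\ range_b a c L)
  | hyperbolic => hyperbolic_formulas a c L F q /\ range_c a L
  | parabolic => parabolic_formulas a c L F q /\ range_c a L
  end.

(* Main.v *)
(* Write rho for the radius of rotation.  Expanding the axis direction and C'' in
   the pseudo-orthonormal frame (C, C', N) gives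
     rho'^2 = (1 + lambda^2) rho^2 - delta,   rho'' = rho (1 - kappa lambda).
   Differentiating the first identity and inserting the second yields
   lambda' rho = - (kappa + lambda) rho'; for kappa = a / lambda this says that
   rho sqrt (lambda^2 + a) is constant, which defines c.  The remaining two
   coordinates are recovered from their polar angle (hyperbolic, circular or
   affine), whose derivative in u is W / (rho^2 - delta) with
   W^2 = lambda^2 rho^2.  Dividing by lambda' turns this rate into
   +- c^2 times the integrand of Psi, the sign being constant by connectedness. *)
Require Import Defs.
From Stdlib Require Import Reals Lra Psatz Ranalysis5.
From Coquelicot Require Import Coquelicot.
Open Scope R_scope.

(** * Linear algebra of the three-dimensional section v = 0 *)

Definition vec3 : Type := (R * R * R)%type.

(* [gt k] on the section v = 0 of the surface, with the radius of rotation as the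
   first coordinate. *)
Definition g3 (k : kind) (a b : vec3) : R :=
  let '(a1, a2, a3) := a in
  let '(b1, b2, b3) := b in
  match k with
  | spherical => a1 * b1 + a2 * b2 - a3 * b3
  | hyperbolic => - (a1 * b1) + a2 * b2 + a3 * b3
  | parabolic => a1 * b3 + a2 * b2 + a3 * b1
  end.

Definition det3 (a b c : vec3) : R :=
  let '(a1, a2, a3) := a in
  let '(b1, b2, b3) := b in
  let '(c1, c2, c3) := c in
  a1 * (b2 * c3 - b3 * c2) - a2 * (b1 * c3 - b3 * c1) + a3 * (b1 * c2 - b2 * c1).

(* Chosen so that [g3 k (axis k) (rho, f, g) = rho] and
   [g3 k (axis k) (axis k) = delta k]. *)
Definition axis (k : kind) : vec3 :=
  match k with
  | spherical => (1, 0, 0) | hyperbolic => (-1, 0, 0) | parabolic => (0, 0, 1)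
  end.

(** The left side is the Gram determinant expanded along its first row. The minus sign is the
    determinant of the metric, which is -1 in each of the three coordinate systems. *)
Lemma gram_det (k : kind) (a b c : vec3) :
  g3 k a a * (g3 k b b * g3 k c c - g3 k b c ^ 2)
  - g3 k a b * (g3 k a b * g3 k c c - g3 k b c * g3 k a c)
  + g3 k a c * (g3 k a b * g3 k b c - g3 k b b * g3 k a c)
  = - det3 a b c ^ 2.
Proof.
destruct a as [[a1 a2] a3], b as [[b1 b2] b3], c as [[c1 c2] c3], k;
  unfold g3, det3; ring.
Qed.

Lemma g3_nondegenerate (k : kind) (a b c d : vec3) :
  det3 a b c <> 0 -> g3 k a d = 0 -> g3 k b d = 0 -> g3 k c d = 0 ->
  d = (0, 0, 0).
Proof.
destruct a as [[a1 a2] a3], b as [[b1 b2] b3], c as [[c1 c2] c3],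
  d as [[d1 d2] d3].
intros hdet ha hb hc.
(* Cramer's rule for the covectors dual to [a], [b], [c]. *)
pose (X := g3 k (a1, a2, a3) (d1, d2, d3)).
pose (Y := g3 k (b1, b2, b3) (d1, d2, d3)).
pose (Z := g3 k (c1, c2, c3) (d1, d2, d3)).
pose (E1 := X * (b2 * c3 - b3 * c2) - Y * (a2 * c3 - a3 * c2)
            + Z * (a2 * b3 - a3 * b2)).
pose (E2 := X * (b1 * c3 - b3 * c1) - Y * (a1 * c3 - a3 * c1)
            + Z * (a1 * b3 - a3 * b1)).
pose (E3 := X * (b1 * c2 - b2 * c1) - Y * (a1 * c2 - a2 * c1)
            + Z * (a1 * b2 - a2 * b1)).
assert (hE : E1 = 0 /\ E2 = 0 /\ E3 = 0).
{ unfold E1, E2, E3, X, Y, Z; rewrite ha, hb, hc; repeat split; ring. }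
destruct hE as [h1 [h2 h3]].
assert (z2 : d2 = 0).
{ apply (Rmult_eq_reg_l (det3 (a1, a2, a3) (b1, b2, b3) (c1, c2, c3))); auto.
  transitivity (- E2); [|rewrite h2; ring].
  unfold E2, X, Y, Z, det3, g3; destruct k; ring. }
assert (z13 : d1 = 0 /\ d3 = 0).
{ split; apply (Rmult_eq_reg_l (det3 (a1, a2, a3) (b1, b2, b3) (c1, c2, c3)));
    auto; rewrite Rmult_0_r.
  (* Lowering the index turns [d] into (d1, d2, - d3), (- d1, d2, d3) or (d3, d2, d1), so the
     cofactor sum that isolates a given coordinate depends on [k]. *)
  - transitivity (match k with
      | spherical => E1 | hyperbolic => - E1 | parabolic => E3 end);
      [|destruct k; lra].
    unfold E1, E3, X, Y, Z, det3, g3; destruct k; ring.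
  - transitivity (match k with
      | spherical => - E3 | hyperbolic => E3 | parabolic => E1 end);
      [|destruct k; lra].
    unfold E1, E3, X, Y, Z, det3, g3; destruct k; ring. }
destruct z13; congruence.
Qed.

(** The Gram determinant of the frame is -1, so the frame is a basis. The difference [d] between [f]
    and its expansion is orthogonal to all three vectors and hence zero. The term in [t] carries a
    minus sign because [t] is timelike. *)
Lemma frame_expansion (k : kind) (c t n e f : vec3) :
  g3 k c c = 1 -> g3 k t t = -1 -> g3 k n n = 1 ->
  g3 k c t = 0 -> g3 k n c = 0 -> g3 k n t = 0 ->
  g3 k e f = g3 k e c * g3 k c f - g3 k e t * g3 k t f + g3 k e n * g3 k n f.
Proof.
intros hcc htt hnn hct hnc hnt.
assert (sym : forall a b, g3 k a b = g3 k b a).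
{ intros [[a1 a2] a3] [[b1 b2] b3]; unfold g3; destruct k; ring. }
assert (hdet : det3 c t n <> 0).
{ intros h0; pose proof (gram_det k c t n) as h.
  rewrite h0, hcc, htt, hnn, hct, (sym c n), (sym t n), hnc, hnt in h; lra. }
pose (comb := fun (x y z : R) =>
  let '(f1, f2, f3) := f in let '(c1, c2, c3) := c in
  let '(t1, t2, t3) := t in let '(n1, n2, n3) := n in
  (f1 - x * c1 + y * t1 - z * n1, f2 - x * c2 + y * t2 - z * n2,
   f3 - x * c3 + y * t3 - z * n3)).
assert (lin : forall x y z a, g3 k a (comb x y z) =
  g3 k a f - x * g3 k a c + y * g3 k a t - z * g3 k a n).
{ intros x y z [[a1 a2] a3]; unfold comb, g3.
  destruct f as [[f1 f2] f3], c as [[c1 c2] c3], t as [[t1 t2] t3],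
    n as [[n1 n2] n3], k; ring. }
pose (d := comb (g3 k c f) (g3 k t f) (g3 k n f)).
assert (hd : d = (0, 0, 0)).
{ apply (g3_nondegenerate k c t n); auto; unfold d; rewrite lin;
  rewrite ?hcc, ?htt, ?hnn, ?hct, ?hnc, ?hnt, ?(sym t c), ?(sym c n),
    ?(sym t n), ?hct, ?hnc, ?hnt; ring. }
assert (h0 : g3 k e d = 0).
{ rewrite hd; destruct e as [[e1 e2] e3]; unfold g3; destruct k; ring. }
unfold d in h0; rewrite lin in h0; lra.
Qed.

(** * Calculus on open intervals *)

Lemma open_interval_convex (S : R -> Prop) (x y t : R) :
  is_open_interval S -> S x -> S y -> x <= t <= y -> S t.
Proof.
intros [lo [hi [_ hS]]] hx hy ht.
apply hS in hx; apply hS in hy; apply hS; split.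
- eapply Rbar_lt_le_trans; [apply hx|apply ht].
- eapply Rbar_le_lt_trans; [|apply hy]; apply ht.
Qed.

Lemma open_interval_between (S : R -> Prop) (x y t : R) :
  is_open_interval S -> S x -> S y -> Rmin x y <= t <= Rmax x y -> S t.
Proof.
intros hS hx hy ht; destruct (Rle_dec x y) as [h|h].
- rewrite Rmin_left, Rmax_right in ht by lra.
  exact (open_interval_convex S x y t hS hx hy ht).
- rewrite Rmin_right, Rmax_left in ht by lra.
  exact (open_interval_convex S y x t hS hy hx ht).
Qed.

Lemma open_interval_locally (S : R -> Prop) (x : R) :
  is_open_interval S -> S x -> locally x S.
Proof.
intros [lo [hi [_ hS]]] hx; apply hS in hx; destruct hx as [h1 h2].
apply (locally_interval S x lo hi h1 h2); intros y hy1 hy2; apply hS; auto.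
Qed.

Lemma open_interval_inhabited (S : R -> Prop) :
  is_open_interval S -> exists x, S x.
Proof.
intros [lo [hi [h hS]]].
destruct lo as [lo| |], hi as [hi| |]; simpl in h; try easy.
- exists ((lo + hi) / 2); apply hS; simpl; lra.
- exists (lo + 1); apply hS; simpl; split; trivial; lra.
- exists (hi - 1); apply hS; simpl; split; trivial; lra.
- exists 0; apply hS; simpl; auto.
Qed.

(** This is the intermediate value theorem in the form that fixes all signs later on: the
    monotonicity of [lam], the sign in front of the integral, the isometry [sg], and the choice
    between the two spherical cases. *)
Lemma nonvanishing_sign (S : R -> Prop) (h : R -> R) :
  is_open_interval S -> (forall x, S x -> continuous h x) ->
  (forall x, S x -> h x <> 0) ->
  exists s, (s = 1 \/ s = -1) /\ forall x, S x -> 0 < s * h x.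
Proof.
intros hS hc hn.
assert (cont : forall e x, S x -> continuity_pt (fun t => e * h t) x).
{ intros e x hx; apply continuity_pt_filterlim.
  apply (continuous_scal_r e h), hc, hx. }
assert (no_change : forall e, (e = 1 \/ e = -1) ->
  forall x y, S x -> S y -> e * h x < 0 -> 0 < e * h y -> x < y -> False).
{ intros e he x y hx hy h1 h2 hxy.
  destruct (IVT_interv (fun t => e * h t) x y) as [z [hz hz0]]; auto.
  - intros t ht; apply cont, (open_interval_convex S x y); auto.
  - assert (hSz : S z) by (apply (open_interval_convex S x y); auto).
    apply hn in hSz; destruct he; subst e; apply hSz; lra. }
assert (same : forall x y, S x -> S y -> 0 < h x -> h y < 0 -> False).
{ intros x y hx hy h1 h2; destruct (Rtotal_order x y) as [hxy|[hxy|hxy]].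
  - apply (no_change (-1) (or_intror eq_refl) x y); auto; lra.
  - subst; lra.
  - apply (no_change 1 (or_introl eq_refl) y x); auto; lra. }
destruct (open_interval_inhabited S hS) as [x0 hx0].
destruct (Rdichotomy _ _ (hn x0 hx0)) as [h0|h0]; [exists (-1)|exists 1];
  split; auto; intros x hx; destruct (Rdichotomy _ _ (hn x hx)) as [h1|h1];
  try lra; exfalso; eauto.
Qed.

Lemma derive_const_on (S : R -> Prop) (h : R -> R) (C u d : R) :
  is_open_interval S -> (forall t, S t -> h t = C) -> S u ->
  is_derive h u d -> d = 0.
Proof.
intros hS hC hu hd.
rewrite <- (is_derive_unique _ _ _ hd).
rewrite (Derive_ext_loc h (fun _ => C) u); [apply Derive_const|].
exact (filter_imp _ _ hC (open_interval_locally S u hS hu)).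
Qed.

Lemma zero_derive_const (S : R -> Prop) (h : R -> R) :
  is_open_interval S -> (forall t, S t -> is_derive h t 0) ->
  forall x y, S x -> S y -> h x = h y.
Proof.
intros hS hd x y hx hy.
destruct (MVT_gen h x y (fun _ => 0)) as [t [_ ht]].
- intros t ht; apply hd, (open_interval_between S x y); auto; lra.
- intros t ht; apply continuity_pt_filterlim.
  apply (ex_derive_continuous h t); exists 0; apply hd.
  apply (open_interval_between S x y); auto.
- lra.
Qed.

Lemma strict_monotone_of_derive_sign (S : R -> Prop) (h dh : R -> R) (s : R) :
  is_open_interval S -> (forall t, S t -> is_derive h t (dh t)) ->
  (forall t, S t -> 0 < s * dh t) ->
  forall x y, S x -> S y -> x < y -> s * h x < s * h y.
Proof.
intros hS hd hs x y hx hy hxy.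
destruct (MVT_gen h x y dh) as [t [ht e]].
- intros t ht; apply hd, (open_interval_between S x y); auto; lra.
- intros t ht; apply continuity_pt_filterlim.
  apply (ex_derive_continuous h t); exists (dh t); apply hd.
  apply (open_interval_between S x y); auto.
- assert (hSt : S t) by (apply (open_interval_between S x y); auto).
  apply hs in hSt.
  assert (0 < (s * dh t) * (y - x)) by (apply Rmult_lt_0_compat; lra).
  nra.
Qed.

(** The derivative of [h] has a constant sign, so [h] is strictly monotone. This makes [U]
    continuous, and the difference quotients of [U] are then reciprocals of those of [h]. *)
Lemma is_derive_inverse (J L : R -> Prop) (h dh U : R -> R) (l : R) :
  is_open_interval J -> is_open_interval L ->
  (forall y, L y -> J (U y) /\ h (U y) = y) ->
  (forall u, J u -> is_derive h u (dh u)) ->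
  (forall u, J u -> continuous dh u) -> (forall u, J u -> dh u <> 0) ->
  L l -> is_derive U l (/ dh (U l)).
Proof.
intros hJ hL hh hd hc hn hl.
destruct (nonvanishing_sign J dh hJ hc hn) as [s [_ hpos]].
pose proof (strict_monotone_of_derive_sign J h dh s hJ hd hpos) as mono.
assert (mono' : forall x y, J x -> J y -> s * h x < s * h y -> x < y).
{ intros x y hx hy hxy; destruct (Rtotal_order x y) as [e|[e|e]]; auto.
  - subst; lra.
  - specialize (mono y x hy hx e); lra. }
destruct (hh l hl) as [hJ0 e0].
set (u0 := U l) in *.
(* For y close to l, the value y lies between those of [h] at u0 - r and u0 + r, and monotonicity
   traps [U y] between these two points. *)
assert (contU : forall eps : posreal, locally l (fun y => L y /\ Rabs (U y - u0) < eps)).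
{ intros eps.
  destruct (open_interval_locally J u0 hJ hJ0) as [del hdel].
  pose (r := Rmin del eps / 2).
  assert (hr : 0 < r /\ r < del /\ r < eps).
  { unfold r; pose proof (cond_pos del); pose proof (cond_pos eps).
    pose proof (Rmin_l del eps); pose proof (Rmin_r del eps).
    assert (0 < Rmin del eps) by (apply Rmin_glb_lt; lra); lra. }
  assert (hb : forall x, Rabs (x - u0) < del -> J x) by (intros x; apply hdel).
  assert (j1 : J (u0 - r)) by (apply hb; apply Rabs_def1; lra).
  assert (j2 : J (u0 + r)) by (apply hb; apply Rabs_def1; lra).
  assert (m1 : s * h (u0 - r) < s * l)
    by (rewrite <- e0; apply mono; auto; lra).
  assert (m2 : s * l < s * h (u0 + r))
    by (rewrite <- e0; apply mono; auto; lra).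
  assert (hloc : locally l (fun y => s * h (u0 - r) < s * y < s * h (u0 + r))).
  { assert (cs : continuous (fun y => s * y) l)
      by (apply (ex_derive_continuous (fun y => s * y)); auto_derive; auto).
    apply (cs (fun z => s * h (u0 - r) < z < s * h (u0 + r))).
  apply (locally_interval _ _ (s * h (u0 - r)) (s * h (u0 + r)));
      simpl; auto. }
  generalize (filter_and _ _ (open_interval_locally L l hL hl) hloc).
  apply filter_imp; intros y [hy [y1 y2]]; split; auto.
  destruct (hh y hy) as [hJy ey]; rewrite <- ey in y1, y2.
  apply mono' in y1; auto; apply mono' in y2; auto; apply Rabs_def1; lra. }
apply is_derive_Reals; intros eps heps.
pose proof (hn u0 hJ0) as hd0; set (m := dh u0) in *.
assert (hm : 0 < Rabs m) by (apply Rabs_pos_lt; auto).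
(* If the quotient q of [h] is within [eta] of m, the first bound gives |q| > |m| / 2, and the
   second then makes |1/q - 1/m| = |q - m| / (|q| |m|) less than [eps]. *)
pose (eta := Rmin (Rabs m / 2) (eps * Rabs m * Rabs m / 2)).
assert (heta : 0 < eta).
{ unfold eta; apply Rmin_glb_lt; [lra|].
  assert (0 < eps * Rabs m) by (apply Rmult_lt_0_compat; auto).
  assert (0 < eps * Rabs m * Rabs m) by (apply Rmult_lt_0_compat; auto); lra. }
assert (heta1 : eta <= Rabs m / 2) by apply Rmin_l.
assert (heta2 : eta <= eps * Rabs m * Rabs m / 2) by apply Rmin_r.
assert (hd' : derivable_pt_lim h u0 m)
  by (apply is_derive_Reals; apply hd; auto).
destruct (hd' eta heta) as [del hdel].
destruct (contU del) as [del' hdel'].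
exists del'; intros x hx0 hx.
assert (hb : Rabs ((l + x) - l) < del') by (replace (l + x - l) with x by ring; auto).
destruct (hdel' (l + x) hb) as [hLy hy].
destruct (hh _ hLy) as [_ ey]; set (k := U (l + x) - u0) in *.
assert (hk0 : k <> 0).
{ intros hk; apply hx0; replace (U (l + x)) with u0 in ey by (unfold k in hk; lra).
  lra. }
specialize (hdel k hk0 hy).
replace (u0 + k) with (U (l + x)) in hdel by (unfold k; ring).
rewrite ey, e0 in hdel; replace (l + x - l) with x in hdel by ring.
fold u0; fold k.
set (q := x / k) in *.
assert (hq : q <> 0) by (apply Rmult_integral_contrapositive_currified; auto;
  apply Rinv_neq_0_compat; auto).
replace (k / x) with (/ q) by (unfold q; field; auto).
assert (hql : Rabs m / 2 < Rabs q).
{ pose proof (Rabs_triang_inv m q) as t; rewrite (Rabs_minus_sym m q) in t; lra. }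
replace (/ q - / m) with (- (q - m) / (q * m)) by (field; auto).
unfold Rdiv; rewrite Rabs_mult, Rabs_Ropp, Rabs_inv, Rabs_mult.
assert (hqm : 0 < Rabs q * Rabs m) by (apply Rmult_lt_0_compat; lra).
apply (Rmult_lt_reg_r (Rabs q * Rabs m)); auto.
rewrite Rmult_assoc, Rinv_l, Rmult_1_r by lra.
assert (eps * Rabs m * (Rabs m / 2) < eps * Rabs m * Rabs q)
  by (apply Rmult_lt_compat_l; auto; apply Rmult_lt_0_compat; auto).
nra.
Qed.

(** * The profile curve and the derivatives of the parametrization at v = 0 *)

(** The radius, [coord2] and [coord3] list the active coordinates in the order that [g3] expects. *)
Definition coord2 (k : kind) (p : profile) : R -> R :=
  match k with spherical => pz p | hyperbolic | parabolic => px p end.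

Definition coord3 (k : kind) (p : profile) : R -> R :=
  match k with spherical | parabolic => pw p | hyperbolic => py p end.

Definition curve3 (k : kind) (p : profile) (u : R) : vec3 :=
  (radius k p u, coord2 k p u, coord3 k p u).

(** Differentiation stays inside [profile], so C' and C'' are again profile curves and share the
    lemmas about C. *)
Definition Dprofile (p : profile) : profile :=
  Profile (Derive (px p)) (Derive (py p)) (Derive (pz p)) (Derive (pw p)).

Lemma Derive4_ext (f g : R -> E4) (t : R) :
  (forall s, f s = g s) -> Derive4 f t = Derive4 g t.
Proof.
intros h; unfold Derive4; repeat apply (f_equal2 pair); apply Derive_ext; intros s; now rewrite h.
Qed.

Lemma profile_curve_curve3 (k : kind) (p : profile) (u : R) :
  profile_curve k p u = match k with
  | spherical => (0, py p u, pz p u, pw p u)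
  | hyperbolic => (px p u, py p u, 0, pw p u)
  | parabolic => (px p u, 0, pz p u, pw p u)
  end.
Proof.
unfold profile_curve, rsurf; rewrite sin_0, cos_0, sinh_0, cosh_0.
destruct k; repeat f_equal; ring.
Qed.

Lemma r_u_0 (k : kind) (p : profile) (u : R) :
  r_u k p u 0 = profile_curve k (Dprofile p) u.
Proof.
unfold r_u; rewrite (Derive4_ext (fun s => rsurf k p s 0) _ u (profile_curve_curve3 k p)).
rewrite profile_curve_curve3; unfold Derive4; destruct k; simpl;
  now rewrite Derive_const.
Qed.

Lemma r_uu_0 (k : kind) (p : profile) (u : R) :
  r_uu k p u 0 = profile_curve k (Dprofile (Dprofile p)) u.
Proof.
unfold r_uu; rewrite (Derive4_ext (fun s => r_u k p s 0) _ u (r_u_0 k p)); apply r_u_0.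
Qed.

Lemma is_derive_sinh (x : R) : is_derive sinh x (cosh x).
Proof. apply is_derive_Reals, derivable_pt_lim_sinh. Qed.

Lemma is_derive_cosh (x : R) : is_derive cosh x (sinh x).
Proof. apply is_derive_Reals, derivable_pt_lim_cosh. Qed.

Lemma r_v_eq (k : kind) (p : profile) (u v : R) :
  r_v k p u v = match k with
  | spherical => (py p u * cos v, - (py p u * sin v), 0, 0)
  | hyperbolic => (0, 0, pw p u * cosh v, pw p u * sinh v)
  | parabolic => (0, pz p u, 0, - (v * pz p u))
  end.
Proof.
unfold r_v, Derive4; destruct k; simpl; rewrite ?Derive_const;
  repeat f_equal; apply is_derive_unique.
- auto_derive; auto; ring.
- auto_derive; auto; ring.
- apply (is_derive_scal sinh), is_derive_sinh.
- apply (is_derive_scal cosh), is_derive_cosh.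
- auto_derive; auto; ring.
- auto_derive; auto; field.
Qed.

Lemma r_vv_0 (k : kind) (p : profile) (u : R) :
  r_vv k p u 0 = match k with
  | spherical => (0, - py p u, 0, 0)
  | hyperbolic => (0, 0, 0, pw p u)
  | parabolic => (0, 0, 0, - pz p u)
  end.
Proof.
unfold r_vv; rewrite (Derive4_ext (fun s => r_v k p u s) _ 0 (r_v_eq k p u)).
unfold Derive4; destruct k; simpl; rewrite ?Derive_const; repeat f_equal;
  apply is_derive_unique.
- auto_derive; auto; rewrite sin_0; ring.
- auto_derive; auto; rewrite cos_0; ring.
- evar_last; [apply (is_derive_scal cosh), is_derive_cosh|].
  simpl; rewrite sinh_0; ring.
- evar_last; [apply (is_derive_scal sinh), is_derive_sinh|].
  simpl; rewrite cosh_0; ring.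
- auto_derive; auto; ring.
Qed.

(** * The frame C, C', N and the equations for the radius *)

Lemma gt_profile_curve (k : kind) (p q : profile) (u : R) :
  gt k (profile_curve k p u) (profile_curve k q u)
  = g3 k (curve3 k p u) (curve3 k q u).
Proof.
rewrite !profile_curve_curve3; destruct k; unfold gt, g3; simpl; ring.
Qed.

(** At v = 0 the vector r_v points along the one coordinate missing from [curve3], so orthogonality
    to it removes that component of N. There r_vv is minus the radius times [axis k], while g(r_v,
    r_v) is the square of the radius; this gives the formula for [lam]. *)
Lemma normal_frame (k : kind) (J : R -> Prop) (p : profile)
  (N : R -> R -> E4) (kap lam : R -> R) (u : R) :
  rotational_surface k (-1) J p -> unit_normal k (-1) J p N ->
  principal_curvatures k J p N kap lam -> J u ->
  exists n : vec3,
    g3 k n (curve3 k p u) = 0 /\ g3 k n (curve3 k (Dprofile p) u) = 0 /\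
    g3 k n n = 1 /\ kap u = g3 k n (curve3 k (Dprofile (Dprofile p)) u) /\
    lam u * radius k p u = - g3 k (axis k) n.
Proof.
intros hp hN hc hu.
assert (hv : vdom k 0) by (destruct k; simpl; auto; pose proof PI_RGT_0; lra).
pose proof (rs_radius _ _ _ _ hp u hu) as hr.
pose proof (un_desitter _ _ _ _ _ hN u 0 hu hv) as h1.
pose proof (un_u _ _ _ _ _ hN u 0 hu hv) as h2.
pose proof (un_v _ _ _ _ _ hN u 0 hu hv) as h3.
pose proof (un_unit _ _ _ _ _ hN u 0 hu hv) as h4.
destruct (hc u 0 hu hv) as [h5 h6].
rewrite r_u_0 in h2; rewrite r_uu_0 in h5; rewrite r_vv_0 in h6.
rewrite r_v_eq in h3, h6.
change (rsurf k p u 0) with (profile_curve k p u) in h1.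
rewrite profile_curve_curve3 in h1, h2, h5.
destruct (N u 0) as [[[n1 n2] n3] n4].
destruct k; simpl in *; rewrite ?sin_0, ?cos_0, ?sinh_0, ?cosh_0 in *.
- assert (z : n1 = 0) by (apply (Rmult_eq_reg_r (py p u)); lra); subst n1.
  exists (n2, n3, n4); repeat split; simpl; try lra.
  rewrite h6; field; lra.
- assert (z : n3 = 0) by (apply (Rmult_eq_reg_r (pw p u)); lra); subst n3.
  exists (n4, n1, n2); repeat split; simpl; try lra.
  rewrite h6; field; lra.
- assert (z : n2 = 0) by (apply (Rmult_eq_reg_r (pz p u)); lra); subst n2.
  exists (n3, n1, n4); repeat split; simpl; try lra.
  rewrite h6; field; lra.
Qed.

Lemma is_derive_coords (k : kind) (J : R -> Prop) (p : profile) (u : R) :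
  rotational_surface k (-1) J p -> J u ->
  (is_derive (radius k p) u (radius k (Dprofile p) u) /\
   is_derive (coord2 k p) u (coord2 k (Dprofile p) u) /\
   is_derive (coord3 k p) u (coord3 k (Dprofile p) u)) /\
  (is_derive (radius k (Dprofile p)) u (radius k (Dprofile (Dprofile p)) u) /\
   is_derive (coord2 k (Dprofile p)) u (coord2 k (Dprofile (Dprofile p)) u) /\
   is_derive (coord3 k (Dprofile p)) u (coord3 k (Dprofile (Dprofile p)) u)).
Proof.
intros hp hu; destruct (rs_smooth _ _ _ _ hp) as [hx [hy [hz hw]]].
assert (h1 : forall f, smooth_on J f -> is_derive f u (Derive f u)).
{ intros f hf; apply Derive_correct, (hf 1%nat u hu). }
assert (h2 : forall f, smooth_on J f ->
  is_derive (Derive f) u (Derive (Derive f) u)).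
{ intros f hf; apply Derive_correct, (hf 2%nat u hu). }
destruct k; simpl; auto 8.
Qed.

Lemma is_derive_g3 (k : kind) (p1 p2 p3 q1 q2 q3 : R -> R) (u : R)
  (p1' p2' p3' q1' q2' q3' : R) :
  is_derive p1 u p1' -> is_derive p2 u p2' -> is_derive p3 u p3' ->
  is_derive q1 u q1' -> is_derive q2 u q2' -> is_derive q3 u q3' ->
  is_derive (fun t => g3 k (p1 t, p2 t, p3 t) (q1 t, q2 t, q3 t)) u
    (g3 k (p1', p2', p3') (q1 u, q2 u, q3 u)
     + g3 k (p1 u, p2 u, p3 u) (q1', q2', q3')).
Proof.
intros h1 h2 h3 h4 h5 h6; unfold g3; destruct k; auto_derive;
  repeat split; try (eexists; eassumption);
  change (Derive (fun x => p1 x)) with (Derive p1);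
  change (Derive (fun x => p2 x)) with (Derive p2);
  change (Derive (fun x => p3 x)) with (Derive p3);
  change (Derive (fun x => q1 x)) with (Derive q1);
  change (Derive (fun x => q2 x)) with (Derive q2);
  change (Derive (fun x => q3 x)) with (Derive q3);
  rewrite (is_derive_unique _ _ _ h1), (is_derive_unique _ _ _ h2),
    (is_derive_unique _ _ _ h3), (is_derive_unique _ _ _ h4),
    (is_derive_unique _ _ _ h5), (is_derive_unique _ _ _ h6); ring.
Qed.

Lemma g3_sym (k : kind) (a b : vec3) : g3 k a b = g3 k b a.
Proof.
destruct a as [[a1 a2] a3], b as [[b1 b2] b3]; unfold g3; destruct k; ring.
Qed.

(** Differentiating g(C, C) = 1 and g(C', C') = -1 gives the two zeros; differentiating g(C, C') = 0
    gives g(C, C'') = - g(C', C') = 1. *)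
Lemma curve_gram (k : kind) (J : R -> Prop) (p : profile) (u : R) :
  rotational_surface k (-1) J p -> J u ->
  g3 k (curve3 k p u) (curve3 k p u) = 1 /\
  g3 k (curve3 k (Dprofile p) u) (curve3 k (Dprofile p) u) = -1 /\
  g3 k (curve3 k p u) (curve3 k (Dprofile p) u) = 0 /\
  g3 k (curve3 k (Dprofile p) u) (curve3 k (Dprofile (Dprofile p)) u) = 0 /\
  g3 k (curve3 k p u) (curve3 k (Dprofile (Dprofile p)) u) = 1.
Proof.
intros hp hu.
pose proof (rs_interval _ _ _ _ hp) as hJ.
assert (e1 : forall t, J t -> g3 k (curve3 k p t) (curve3 k p t) = 1).
{ intros t ht; rewrite <- gt_profile_curve; exact (rs_desitter _ _ _ _ hp t ht). }
assert (e2 : forall t, J t ->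
  g3 k (curve3 k (Dprofile p) t) (curve3 k (Dprofile p) t) = -1).
{ intros t ht; rewrite <- gt_profile_curve, <- r_u_0.
  exact (rs_arclength _ _ _ _ hp t ht). }
assert (e3 : forall t, J t -> g3 k (curve3 k p t) (curve3 k (Dprofile p) t) = 0).
{ intros t ht; destruct (is_derive_coords k J p t hp ht) as [[a1 [a2 a3]] _].
  pose proof (derive_const_on J _ _ t _ hJ e1 ht
    (is_derive_g3 k _ _ _ _ _ _ t _ _ _ _ _ _ a1 a2 a3 a1 a2 a3)) as h.
  rewrite (g3_sym k (radius k (Dprofile p) t, _, _)) in h.
  unfold curve3; lra. }
destruct (is_derive_coords k J p u hp hu) as [[a1 [a2 a3]] [b1 [b2 b3]]].
repeat split; auto.
- pose proof (derive_const_on J _ _ u _ hJ e2 hu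
    (is_derive_g3 k _ _ _ _ _ _ u _ _ _ _ _ _ b1 b2 b3 b1 b2 b3)) as h.
  rewrite (g3_sym k (radius k (Dprofile (Dprofile p)) u, _, _)) in h.
  unfold curve3; lra.
- pose proof (derive_const_on J _ _ u _ hJ e3 hu
    (is_derive_g3 k _ _ _ _ _ _ u _ _ _ _ _ _ a1 a2 a3 b1 b2 b3)) as h.
  specialize (e2 u hu); unfold curve3 in *; lra.
Qed.

Lemma radius_equations (k : kind) (J : R -> Prop) (p : profile)
  (N : R -> R -> E4) (kap lam : R -> R) (u : R) :
  rotational_surface k (-1) J p -> unit_normal k (-1) J p N ->
  principal_curvatures k J p N kap lam -> J u ->
  radius k (Dprofile p) u ^ 2 = (1 + lam u ^ 2) * radius k p u ^ 2 - delta k /\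
  radius k (Dprofile (Dprofile p)) u = radius k p u * (1 - kap u * lam u).
Proof.
intros hp hN hc hu.
destruct (normal_frame k J p N kap lam u hp hN hc hu) as [n [n1 [n2 [n3 [n4 n5]]]]].
destruct (curve_gram k J p u hp hu) as [c1 [c2 [c3 [c4 c5]]]].
assert (ax : forall q, g3 k (axis k) (curve3 k q u) = radius k q u).
{ intros q; destruct k; simpl; ring. }
assert (axx : g3 k (axis k) (axis k) = delta k) by (destruct k; simpl; ring).
(* [E] becomes delta = rho^2 - rho'^2 + (lambda rho)^2. In [F] the C' term drops out because g(C',
   C'') = 0. *)
pose proof (frame_expansion k _ _ n (axis k) (axis k) c1 c2 n3 c3 n1 n2) as E.
pose proof (frame_expansion k _ _ n (axis k) (curve3 k (Dprofile (Dprofile p)) u)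
  c1 c2 n3 c3 n1 n2) as F.
rewrite !(g3_sym k (curve3 k _ u) (axis k)), (g3_sym k n (axis k)), !ax, axx in E.
rewrite !ax, c5, c4, <- n4 in F.
assert (n5' : g3 k (axis k) n = - (lam u * radius k p u)) by lra.
rewrite n5' in E, F; split; lra.
Qed.

(* For [q] the derivative of [p], up to sign the component of C x C' along the
   rotation axis. *)
Definition swirl (k : kind) (p q : profile) (u : R) : R :=
  match k with
  | spherical => pw p u * pz q u - pz p u * pw q u
  | hyperbolic => px p u * py q u - py p u * px q u
  | parabolic => pz p u * px q u - px p u * pz q u
  end.

(** This evaluates the Gram determinant of C, C' and the axis, since [swirl] is up to sign the
    determinant of these three vectors. *)
Lemma swirl_sq (k : kind) (J : R -> Prop) (p : profile) (u : R) :
  rotational_surface k (-1) J p -> J u ->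
  swirl k p (Dprofile p) u ^ 2
  = radius k (Dprofile p) u ^ 2 - radius k p u ^ 2 + delta k.
Proof.
intros hp hu; destruct (curve_gram k J p u hp hu) as [c1 [c2 [c3 _]]].
pose proof (gram_det k (curve3 k p u) (curve3 k (Dprofile p) u) (axis k)) as G.
assert (ax : forall q, g3 k (curve3 k q u) (axis k) = radius k q u).
{ intros q; destruct k; simpl; ring. }
assert (axx : g3 k (axis k) (axis k) = delta k) by (destruct k; simpl; ring).
rewrite !ax, axx, c1, c2, c3 in G.
replace (swirl k p (Dprofile p) u ^ 2) with
  (det3 (curve3 k p u) (curve3 k (Dprofile p) u) (axis k) ^ 2)
  by (destruct k; simpl; ring).
lra.
Qed.

(** * Hyperbolic and circular polar angles along a curve *)

Lemma cosh_arcsinh (x : R) : cosh (arcsinh x) = sqrt (x ^ 2 + 1).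
Proof.
symmetry; apply sqrt_lem_1.
- pose proof (pow2_ge_0 x); lra.
- unfold cosh; pose proof (exp_pos (arcsinh x)); pose proof (exp_pos (- arcsinh x)).
  lra.
- rewrite <- (sinh_arcsinh x) at 3; generalize (arcsinh x); intros t.
  assert (h : exp t * exp (- t) = 1) by (rewrite <- exp_plus, Rplus_opp_r; apply exp_0).
  unfold cosh, sinh; nra.
Qed.

(** Since f^2 > g^2, the function [f] never vanishes, and its constant sign [sg] selects a branch of
    the hyperbola. On that branch arcsinh is a global angle. *)
Lemma hyperbolic_angle (J : R -> Prop) (f g df dg : R -> R) :
  is_open_interval J ->
  (forall u, J u -> is_derive f u (df u)) ->
  (forall u, J u -> is_derive g u (dg u)) ->
  (forall u, J u -> 0 < f u ^ 2 - g u ^ 2) ->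
  exists (sg : R) (F : R -> R), (sg = 1 \/ sg = -1) /\
    forall u, J u ->
      f u = sg * (sqrt (f u ^ 2 - g u ^ 2) * cosh (F u)) /\
      g u = sg * (sqrt (f u ^ 2 - g u ^ 2) * sinh (F u)) /\
      is_derive F u ((f u * dg u - g u * df u) / (f u ^ 2 - g u ^ 2)).
Proof.
intros hJ hf hg hpos.
destruct (nonvanishing_sign J f hJ) as [sg [hsg hs]].
{ intros u hu; apply (ex_derive_continuous f); eexists; apply hf, hu. }
{ intros u hu h0; specialize (hpos u hu); rewrite h0 in hpos; nra. }
exists sg, (fun u => arcsinh (sg * (g u / sqrt (f u ^ 2 - g u ^ 2)))).
split; auto; intros u hu.
specialize (hpos u hu); specialize (hs u hu); specialize (hf u hu);
  specialize (hg u hu).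
pose proof (sqrt_lt_R0 _ hpos) as hq.
pose proof (sqrt_sqrt _ (Rlt_le _ _ hpos)) as hqq.
set (q := sqrt (f u ^ 2 - g u ^ 2)) in *.
assert (sg2 : sg * sg = 1) by (destruct hsg; subst sg; ring).
assert (hsq : sqrt ((sg * (g u / q)) ^ 2 + 1) = sg * f u / q).
{ apply sqrt_lem_1.
  - pose proof (pow2_ge_0 (sg * (g u / q))); lra.
  - apply Rlt_le, Rdiv_lt_0_compat; auto.
  - field_simplify; [|lra|lra].
    replace (sg ^ 2) with 1 by lra.
    replace (q ^ 2) with (f u ^ 2 - g u ^ 2) by lra; field; lra. }
split; [|split].
- rewrite cosh_arcsinh, hsq; field_simplify; [|lra]; replace (sg ^ 2) with 1 by lra; ring.
- rewrite sinh_arcsinh; field_simplify; [|lra]; replace (sg ^ 2) with 1 by lra; ring.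
- assert (dq : is_derive (fun t => sqrt (f t ^ 2 - g t ^ 2)) u
    ((f u * df u - g u * dg u) / q)).
  { evar_last; [apply (is_derive_sqrt (fun t => f t ^ 2 - g t ^ 2) u
      (2 * (f u * df u - g u * dg u)))|fold q; field; lra]; auto.
    auto_derive; [repeat split; eexists; eassumption|].
    change (Derive (fun x => f x)) with (Derive f).
    change (Derive (fun x => g x)) with (Derive g).
    rewrite (is_derive_unique _ _ _ hf), (is_derive_unique _ _ _ hg); ring. }
  evar_last.
  { apply (is_derive_comp arcsinh).
    - apply is_derive_Reals, derivable_pt_lim_arcsinh.
    - apply (is_derive_scal (fun t => g t / sqrt (f t ^ 2 - g t ^ 2))).
      apply (is_derive_div g _ u _ _ hg dq); fold q; lra. }
  fold q; rewrite hsq; unfold scal; simpl; unfold mult; simpl.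
  (* With denominators cleared, q^2 = f^2 - g^2 turns g' q^2 - g (f f' - g g') into f (f g' - g
     f'). *)
  apply (Rmult_eq_reg_l (sg * f u * (q * q))); [|nra].
  replace (f u * (f u * 1) - g u * (g u * 1)) with (q * q) by lra.
  assert (hsf : sg <> 0 /\ f u <> 0) by nra.
  transitivity (sg * (dg u * (q * q) - g u * (f u * df u - g u * dg u))).
  + field; repeat split; tauto || lra.
  + rewrite hqq at 1; field; lra.
Qed.

Lemma unit_angle (x y : R) :
  x ^ 2 + y ^ 2 = 1 -> exists t, x = cos t /\ y = sin t.
Proof.
intros h; assert (hx : -1 <= x <= 1) by nra.
assert (e : sqrt (1 - x²) = Rabs y).
{ rewrite <- sqrt_Rsqr_abs; f_equal; unfold Rsqr; lra. }
destruct (Rle_dec 0 y) as [hy|hy]; [exists (acos x)|exists (- acos x)];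
  rewrite ?cos_neg, ?sin_neg, cos_acos, sin_acos, e by auto; split; auto.
- now rewrite Rabs_pos_eq.
- rewrite Rabs_left by lra; ring.
Qed.

(** The angle is the integral of the angular speed [phi], started at an angle of the initial vector.
    Then (cos F, sin F) and (X, Y) obey the same linear system with the same initial value. *)
Lemma rotating_unit_vector (J : R -> Prop) (X Y phi : R -> R) :
  is_open_interval J ->
  (forall u, J u -> continuous phi u) ->
  (forall u, J u -> X u ^ 2 + Y u ^ 2 = 1) ->
  (forall u, J u -> is_derive X u (- (phi u * Y u))) ->
  (forall u, J u -> is_derive Y u (phi u * X u)) ->
  exists F : R -> R, forall u, J u ->
    X u = cos (F u) /\ Y u = sin (F u) /\ is_derive F u (phi u).
Proof.
intros hJ hc h1 hX hY.
destruct (open_interval_inhabited J hJ) as [u0 hu0].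
destruct (unit_angle (X u0) (Y u0) (h1 u0 hu0)) as [t0 [hx0 hy0]].
pose (F := fun u => t0 + RInt phi u0 u).
assert (hF : forall u, J u -> is_derive F u (phi u)).
{ intros u hu; unfold F; evar_last.
  - apply (is_derive_plus (fun _ => t0) (RInt phi u0)); [apply is_derive_const|].
    apply (is_derive_RInt phi (RInt phi u0) u0 u); [|apply hc, hu].
    generalize (open_interval_locally J u hJ hu); apply filter_imp.
    intros v hv; apply (RInt_correct phi), (ex_RInt_continuous phi).
    intros z hz; apply hc, (open_interval_between J u0 v); auto.
  - apply plus_zero_l. }
assert (F0 : F u0 = t0) by (unfold F; rewrite RInt_point; apply Rplus_0_r).
(* [A] and [B] are the components of (X, Y) in the frame turned by [F]; they are constant, with
   values 1 and 0. *)
pose (A := fun u => X u * cos (F u) + Y u * sin (F u)).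
pose (B := fun u => Y u * cos (F u) - X u * sin (F u)).
assert (hAB : forall u, J u -> is_derive A u 0 /\ is_derive B u 0).
{ intros u hu; specialize (hX u hu); specialize (hY u hu); specialize (hF u hu).
  clearbody F; split; unfold A, B; (auto_derive;
    [repeat split; eexists; eassumption|
     change (Derive (fun x => X x)) with (Derive X);
     change (Derive (fun x => Y x)) with (Derive Y);
     change (Derive (fun x => F x)) with (Derive F);
     rewrite (is_derive_unique _ _ _ hX), (is_derive_unique _ _ _ hY),
       (is_derive_unique _ _ _ hF); ring]). }
exists F; intros u hu.
assert (eA : A u = 1).
{ rewrite (zero_derive_const J A hJ (fun t ht => proj1 (hAB t ht)) u u0 hu hu0).
  unfold A; rewrite F0, hx0, hy0; pose proof (sin2_cos2 t0) as h.
  unfold Rsqr in h; lra. }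
assert (eB : B u = 0).
{ rewrite (zero_derive_const J B hJ (fun t ht => proj2 (hAB t ht)) u u0 hu hu0).
  unfold B; rewrite F0, hx0, hy0; ring. }
pose proof (sin2_cos2 (F u)) as h; unfold Rsqr in h; unfold A, B in eA, eB.
split; [|split; auto].
- transitivity (X u * (sin (F u) * sin (F u) + cos (F u) * cos (F u)));
    [rewrite h; ring|].
  transitivity (cos (F u) * (X u * cos (F u) + Y u * sin (F u))
    - sin (F u) * (Y u * cos (F u) - X u * sin (F u))); [ring|].
  rewrite eA, eB; ring.
- transitivity (Y u * (sin (F u) * sin (F u) + cos (F u) * cos (F u)));
    [rewrite h; ring|].
  transitivity (sin (F u) * (X u * cos (F u) + Y u * sin (F u))
    + cos (F u) * (Y u * cos (F u) - X u * sin (F u))); [ring|].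
  rewrite eA, eB; ring.
Qed.

(** Dividing (f, g) by its norm gives a unit vector that rotates with speed (f g' - g f') / (f^2 +
    g^2). Continuity of [df] and [dg] makes this speed integrable. *)
Lemma circular_angle (J : R -> Prop) (f g df dg : R -> R) :
  is_open_interval J ->
  (forall u, J u -> is_derive f u (df u) /\ continuous df u) ->
  (forall u, J u -> is_derive g u (dg u) /\ continuous dg u) ->
  (forall u, J u -> 0 < f u ^ 2 + g u ^ 2) ->
  exists F : R -> R,
    forall u, J u ->
      f u = sqrt (f u ^ 2 + g u ^ 2) * cos (F u) /\
      g u = sqrt (f u ^ 2 + g u ^ 2) * sin (F u) /\
      is_derive F u ((f u * dg u - g u * df u) / (f u ^ 2 + g u ^ 2)).
Proof.
intros hJ hf hg hpos.
pose (q := fun u => sqrt (f u ^ 2 + g u ^ 2)).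
assert (hq : forall u, J u -> 0 < q u) by (intros u hu; apply sqrt_lt_R0; auto).
assert (hqq : forall u, J u -> q u * q u = f u ^ 2 + g u ^ 2).
{ intros u hu; apply sqrt_sqrt, Rlt_le; auto. }
assert (dq : forall u, J u -> is_derive q u ((f u * df u + g u * dg u) / q u)).
{ intros u hu; destruct (hf u hu) as [hf' _]; destruct (hg u hu) as [hg' _].
  specialize (hq u hu); specialize (hpos u hu); unfold q in *.
  evar_last; [apply (is_derive_sqrt (fun t => f t ^ 2 + g t ^ 2) u
    (2 * (f u * df u + g u * dg u)))|field; lra]; auto.
  auto_derive; [repeat split; eexists; eassumption|].
  change (Derive (fun x => f x)) with (Derive f).
  change (Derive (fun x => g x)) with (Derive g).
  rewrite (is_derive_unique _ _ _ hf'), (is_derive_unique _ _ _ hg'); ring. }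
destruct (rotating_unit_vector J (fun u => f u / q u) (fun u => g u / q u)
  (fun u => (f u * dg u - g u * df u) / (f u ^ 2 + g u ^ 2))) as [F hF]; auto.
- intros u hu; destruct (hf u hu) as [hf' cf]; destruct (hg u hu) as [hg' cg].
  assert (cf' : continuous f u) by (apply (ex_derive_continuous f); eexists; eauto).
  assert (cg' : continuous g u) by (apply (ex_derive_continuous g); eexists; eauto).
  specialize (hpos u hu).
  apply continuity_pt_filterlim in cf, cg, cf', cg'; apply continuity_pt_filterlim.
  apply (continuity_pt_div (fun u => f u * dg u - g u * df u)
    (fun u => f u ^ 2 + g u ^ 2)); [| |lra].
  + apply (continuity_pt_minus (fun u => f u * dg u) (fun u => g u * df u));
      apply continuity_pt_mult; auto.
  + apply (continuity_pt_ext (fun u => f u * f u + g u * g u));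
      [intros; ring|].
    apply (continuity_pt_plus (fun u => f u * f u) (fun u => g u * g u));
      apply continuity_pt_mult; auto.
- intros u hu; specialize (hq u hu); specialize (hqq u hu).
  specialize (hpos u hu); field_simplify; [|lra].
  replace (q u ^ 2) with (f u ^ 2 + g u ^ 2) by lra; field; lra.
- intros u hu; destruct (hf u hu) as [hf' _]; specialize (hq u hu);
    specialize (hqq u hu); specialize (dq u hu).
  rewrite <- hqq; evar_last; [apply (is_derive_div f q u _ _ hf' dq); lra|].
  transitivity ((df u * (q u * q u) - f u * (f u * df u + g u * dg u))
    / (q u * q u * q u)); [field; lra|rewrite hqq at 1; field; lra].
- intros u hu; destruct (hg u hu) as [hg' _]; specialize (hq u hu);
    specialize (hqq u hu); specialize (dq u hu).
  rewrite <- hqq; evar_last; [apply (is_derive_div g q u _ _ hg' dq); lra|].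
  transitivity ((dg u * (q u * q u) - g u * (f u * df u + g u * dg u))
    / (q u * q u * q u)); [field; lra|rewrite hqq at 1; field; lra].
- exists F; intros u hu; destruct (hF u hu) as [e1 [e2 e3]].
  specialize (hq u hu); cbn beta in e1, e2; change (sqrt (f u ^ 2 + g u ^ 2)) with (q u).
  rewrite <- e1, <- e2; split; [|split; auto]; field; lra.
Qed.

(** * The Weingarten relation: derivative of lambda, the constant c, and the integrand *)

Lemma is_derive_lam (k : kind) (J : R -> Prop) (p : profile)
  (N : R -> R -> E4) (kap lam : R -> R) (a u : R) :
  rotational_surface k (-1) J p -> unit_normal k (-1) J p N ->
  principal_curvatures k J p N kap lam ->
  (forall t, J t -> lam t <> 0 /\ kap t = a / lam t) ->
  (forall t, J t -> ex_derive lam t) -> J u ->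
  is_derive lam u
    (- ((lam u ^ 2 + a) * radius k (Dprofile p) u) / (lam u * radius k p u)).
Proof.
intros hp hN hc hw hd hu.
destruct (is_derive_coords k J p u hp hu) as [[d1 _] [d2 _]].
pose proof (Derive_correct _ _ (hd u hu)) as dl.
destruct (hw u hu) as [hl0 hk].
destruct (radius_equations k J p N kap lam u hp hN hc hu) as [_ e2].
pose proof (rs_radius _ _ _ _ hp u hu) as hr.
rewrite hk in e2.
replace (a / lam u * lam u) with a in e2 by (field; auto).
(* By the first radius equation this function is constantly [- delta k], so its derivative vanishes.
   That is a linear equation for [Derive lam u], in which rho'' is replaced by rho (1 - a). *)
assert (h : is_derive
  (fun t => radius k (Dprofile p) t ^ 2 - (1 + lam t ^ 2) * radius k p t ^ 2) u
  (2 * radius k (Dprofile p) u * radius k (Dprofile (Dprofile p)) u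
   - (2 * lam u * Derive lam u * radius k p u ^ 2
      + (1 + lam u ^ 2) * (2 * radius k p u * radius k (Dprofile p) u)))).
{ auto_derive; [repeat split; solve [auto | eexists; eassumption]|].
  change (Derive (fun x => radius k p x)) with (Derive (radius k p)).
  change (Derive (fun x => radius k (Dprofile p) x))
    with (Derive (radius k (Dprofile p))).
  rewrite (is_derive_unique _ _ _ d1), (is_derive_unique _ _ _ d2);
  change (Derive (fun x => lam x)) with (Derive lam); ring. }
apply (derive_const_on J _ (- delta k)) in h; auto.
- rewrite e2 in h.
  replace (- ((lam u ^ 2 + a) * radius k (Dprofile p) u) / (lam u * radius k p u))
    with (Derive lam u); auto.
  apply (Rmult_eq_reg_r (2 * radius k p u * (lam u * radius k p u))).
  + field_simplify; [lra|split; lra].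
  + repeat apply Rmult_integral_contrapositive_currified; lra.
- exact (rs_interval _ _ _ _ hp).
- intros t ht.
  destruct (radius_equations k J p N kap lam t hp hN hc ht) as [e1 _]; lra.
Qed.

(** The derivative of the square rho^2 (lambda^2 + a) cancels by the formula for lambda'; working
    with the square keeps the root out of the computation, and positivity recovers the product
    itself. *)
Lemma radius_lam_conserved (k : kind) (J : R -> Prop) (p : profile)
  (N : R -> R -> E4) (kap lam : R -> R) (a : R) :
  rotational_surface k (-1) J p -> unit_normal k (-1) J p N ->
  principal_curvatures k J p N kap lam ->
  (forall t, J t -> lam t <> 0 /\ kap t = a / lam t) ->
  (forall t, J t -> ex_derive lam t) ->
  (forall t, J t -> 0 < lam t ^ 2 + a) ->
  exists c, 0 < c /\ forall u, J u -> radius k p u * sqrt (lam u ^ 2 + a) = c.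
Proof.
intros hp hN hc hw hd hpos.
pose proof (rs_interval _ _ _ _ hp) as hJ.
destruct (open_interval_inhabited J hJ) as [u0 hu0].
pose (E := fun u => radius k p u ^ 2 * (lam u ^ 2 + a)).
assert (hE : forall u, J u -> is_derive E u 0).
{ intros u hu.
  pose proof (is_derive_lam k J p N kap lam a u hp hN hc hw hd hu) as dl.
  destruct (is_derive_coords k J p u hp hu) as [[d1 _] _].
  pose proof (rs_radius _ _ _ _ hp u hu) as hr; destruct (hw u hu) as [hl _].
  unfold E; auto_derive; [repeat split; eexists; eassumption|].
  change (Derive (fun x => radius k p x)) with (Derive (radius k p)).
  change (Derive (fun x => lam x)) with (Derive lam).
  rewrite (is_derive_unique _ _ _ d1), (is_derive_unique _ _ _ dl).
  field; split; lra. }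
assert (hs : forall u, J u -> 0 < radius k p u * sqrt (lam u ^ 2 + a)).
{ intros u hu; apply Rmult_lt_0_compat; [exact (rs_radius _ _ _ _ hp u hu)|].
  apply sqrt_lt_R0; auto. }
exists (radius k p u0 * sqrt (lam u0 ^ 2 + a)); split; auto.
intros u hu; apply Rsqr_inj; try (apply Rlt_le; auto).
pose proof (zero_derive_const J E hJ hE u u0 hu hu0) as e; unfold E in e.
pose proof (sqrt_sqrt _ (Rlt_le _ _ (hpos u hu))) as s1.
pose proof (sqrt_sqrt _ (Rlt_le _ _ (hpos u0 hu0))) as s2.
unfold Rsqr.
transitivity (radius k p u ^ 2 * (sqrt (lam u ^ 2 + a) * sqrt (lam u ^ 2 + a)));
  [ring|rewrite s1, e].
transitivity (radius k p u0 ^ 2 * (sqrt (lam u0 ^ 2 + a) * sqrt (lam u0 ^ 2 + a)));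
  [rewrite s2|]; ring.
Qed.

(** Write q for sqrt (l^2 + a). Then c = rho q turns c^2 - delta (l^2 + a) into q^2 (rho^2 - delta)
    and the second root into |rho'| q. The hypotheses give W^2 = l^2 rho^2, so [W] is known up to
    the sign [s]: it equals s l rho |rho'| / rho'. *)
Lemma Psi_rate (k : kind) (a c l rho drho W s : R) :
  0 < rho -> 0 < l ^ 2 + a -> l <> 0 -> rho * sqrt (l ^ 2 + a) = c ->
  drho ^ 2 = (1 + l ^ 2) * rho ^ 2 - delta k ->
  W ^ 2 = drho ^ 2 - rho ^ 2 + delta k ->
  drho <> 0 -> c ^ 2 - delta k * (l ^ 2 + a) <> 0 ->
  (s = 1 \/ s = -1) -> 0 < s * (W * drho * l) ->
  W / (rho ^ 2 - delta k) / (- ((l ^ 2 + a) * drho) / (l * rho))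
  = - s * c ^ 2 * Psi_integrand k a c l.
Proof.
intros hr hp hl hc hd hW hd0 hn hs hsg.
pose proof (sqrt_lt_R0 _ hp) as hq; pose proof (sqrt_sqrt _ (Rlt_le _ _ hp)) as hqq.
unfold Psi_integrand; set (q := sqrt (l ^ 2 + a)) in *.
set (m := Rabs drho).
assert (hm : 0 < m) by (apply Rabs_pos_lt; auto).
assert (hmm : m ^ 2 = drho ^ 2) by apply pow2_abs.
assert (hr2 : sqrt ((l ^ 2 + 1) * c ^ 2 - delta k * (l ^ 2 + a)) = m * q).
{ apply sqrt_lem_1; [|nra|].
  - rewrite <- hc, <- hqq.
    replace ((l ^ 2 + 1) * (rho * q) ^ 2 - delta k * (q * q))
      with ((m * q) ^ 2) by (rewrite Rpow_mult_distr, hmm, hd; ring).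
    apply pow2_ge_0.
  - rewrite <- hc, <- hqq.
    replace (m * q * (m * q)) with (m ^ 2 * q ^ 2) by ring.
    rewrite hmm, hd; ring. }
assert (hT : s * (W * drho * l) = l ^ 2 * rho * m).
{ apply Rsqr_inj; [lra| |].
  - pose proof (pow2_ge_0 l); apply Rmult_le_pos; [apply Rmult_le_pos|]; lra.
  - unfold Rsqr.
    assert (s2 : s * s = 1) by (destruct hs; subst s; ring).
    transitivity ((s * s) * (W ^ 2 * drho ^ 2 * l ^ 2)); [ring|].
    transitivity ((l ^ 2 * rho ^ 2) * m ^ 2 * l ^ 2); [|ring].
    rewrite s2, hmm, hW, hd; ring. }
assert (hWe : W = s * (l * rho * m) / drho).
{ apply (Rmult_eq_reg_r (drho * l)); [|apply Rmult_integral_contrapositive_currified; auto].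
  transitivity (s * s * (W * drho * l)); [destruct hs; subst s; ring|].
  rewrite Rmult_assoc, hT; field; auto. }
rewrite hr2, hWe, <- hqq, <- hc.
assert (hn' : rho ^ 2 - delta k <> 0).
{ intros h0; apply hn; rewrite <- hc, <- hqq.
  replace (delta k) with (rho ^ 2) by lra; ring. }
transitivity (- (s * (l * rho) ^ 2 * m) / (drho ^ 2 * (rho ^ 2 - delta k) * q ^ 2)).
- field; repeat split; lra.
- rewrite <- hmm; field; repeat split; try lra.
  rewrite <- hc, <- hqq in hn. nra.
Qed.

(** The antiderivative is taken to be [F] rescaled by s / c^2, so it absorbs the constant of
    integration and [psi0] can be 0. *)
Lemma is_Psi_of_derive (k : kind) (a c s : R) (L : R -> Prop) (F : R -> R) :
  0 < c -> (s = 1 \/ s = -1) ->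
  (forall l, L l -> is_derive F l (s * c ^ 2 * Psi_integrand k a c l)) ->
  is_Psi k a c 0 L F.
Proof.
intros hc hs hF; exists s, (fun l => s / c ^ 2 * F l); split; auto.
assert (s2 : s * s = 1) by (destruct hs; subst s; ring).
split; intros l hl.
- evar_last; [apply (is_derive_scal F), hF, hl|].
  transitivity ((s * s) * Psi_integrand k a c l); [field; lra|rewrite s2; ring].
- transitivity ((s * s) * F l); [rewrite s2; ring|field; lra].
Qed.

(** * The ranges of lambda *)

Lemma sq_gt_cases (x m : R) : 0 <= m -> m < x ^ 2 -> x < - sqrt m \/ sqrt m < x.
Proof.
intros hm h; pose proof (sqrt_pos m); pose proof (sqrt_sqrt m hm).
destruct (Rlt_dec x 0); [left|right]; nra.
Qed.

Lemma sq_lt_bounds (x m : R) : x ^ 2 < m -> - sqrt m < x < sqrt m.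
Proof.
intros h; assert (hm : 0 <= m) by (pose proof (pow2_ge_0 x); lra).
pose proof (sqrt_pos m); pose proof (sqrt_sqrt m hm); split; nra.
Qed.

(** The last bound says l^2 (c^2 - 1) > a - c^2. For c^2 < 1 it bounds l^2 from above and, at the
    given point of [L], forces a < c^2; for c^2 = 1 it reads a < 1; for c^2 > 1 it restricts l only
    if a >= c^2, and a = c^2 leaves just l <> 0. *)
Lemma range_a_of_bounds (a c : R) (L : R -> Prop) :
  (exists l, L l) ->
  (forall l, L l -> l <> 0 /\ 0 < l ^ 2 + a /\ c ^ 2 < l ^ 2 + a /\
    0 < (l ^ 2 + 1) * c ^ 2 - (l ^ 2 + a)) ->
  range_a a c L.
Proof.
intros [l0 hl0] h; unfold range_a.
destruct (h l0 hl0) as [_ [_ [_ hD0]]]; pose proof (pow2_ge_0 l0) as hl2.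
destruct (Rtotal_order (c ^ 2) 1) as [h1|[h1|h1]].
- assert (hac : a < c ^ 2) by nra.
  right; left; split; [lra|]; intros l hl; destruct (h l hl) as [_ [_ [h2 h3]]].
  assert (h4 : l ^ 2 < (c ^ 2 - a) / (1 - c ^ 2))
    by (apply (Rlt_div_r (l ^ 2)); lra).
  apply sq_lt_bounds in h4.
  destruct (sq_gt_cases l (c ^ 2 - a)); lra.
- right; right; right; left; split; [nra|split; [lra|]].
  intros l hl; destruct (h l hl) as [_ [_ [h2 h3]]].
  apply sq_gt_cases; nra.
- destruct (Rtotal_order a (c ^ 2)) as [h2|[h2|h2]].
  + left; split; [apply Rmax_lub_lt; lra|].
    intros l hl; destruct (h l hl) as [_ [_ [h3 h4]]]; apply sq_gt_cases; lra.
  + right; right; right; right; split; [lra|split; [lra|]].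
    intros l hl; destruct (h l hl) as [h3 _]; lra.
  + right; right; left; split; [lra|].
    intros l hl; destruct (h l hl) as [_ [_ [h3 h4]]]; apply sq_gt_cases.
    * apply Rlt_le, Rdiv_lt_0_compat; lra.
    * apply (Rlt_div_l (a - c ^ 2)); lra.
Qed.

Lemma range_b_of_bounds (a c : R) (L : R -> Prop) :
  (exists l, L l) -> (forall l, L l -> 0 < l ^ 2 + a /\ l ^ 2 + a < c ^ 2) ->
  range_b a c L.
Proof.
intros [l0 hl0] h; unfold range_b.
destruct (h l0 hl0) as [_ h0]; pose proof (pow2_ge_0 l0) as hl2.
assert (hb : forall l, L l -> - sqrt (c ^ 2 - a) < l < sqrt (c ^ 2 - a)).
{ intros l hl; destruct (h l hl); apply sq_lt_bounds; lra. }
destruct (Rle_dec 0 a) as [ha|ha]; [left; split; [lra|auto]|right].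
assert (hg : forall l, L l ->
  - sqrt (c ^ 2 - a) < l < - sqrt (- a) \/ sqrt (- a) < l < sqrt (c ^ 2 - a)).
{ intros l hl; pose proof (hb l hl); destruct (h l hl).
  destruct (sq_gt_cases l (- a)); lra. }
destruct (Rlt_dec c 1); [left|right]; repeat split; auto; lra.
Qed.

Lemma range_c_of_bounds (a : R) (L : R -> Prop) :
  (forall l, L l -> 0 < l ^ 2 + a) -> range_c a L.
Proof.
intros h; unfold range_c; destruct (Rle_dec 0 a) as [ha|ha]; [auto|left].
split; [lra|]; intros l hl; specialize (h l hl); apply sq_gt_cases; lra.
Qed.

(** * Classification of the profile curves in the parameter lambda *)

Theorem corollary3p6 (k : kind) (J L : R -> Prop) (p : profile)
  (N : R -> R -> E4) (kap lam U : R -> R) (a : R)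
  (Hsurf : rotational_surface k (-1) J p)
  (HN : unit_normal k (-1) J p N)
  (Hcurv : principal_curvatures k J p N kap lam)
  (Hweingarten : forall u, J u -> lam u <> 0 /\ kap u = a / lam u)
  (HL : is_open_interval L)
  (Hparam : change_of_parameter J L lam U)
  (Hpos : forall l, L l -> 0 < l ^ 2 + a) :
  exists c : R, 0 < c /\
    (forall l, L l ->
       radius k (reparam p U) l = c / sqrt (l ^ 2 + a) /\
       0 < (l ^ 2 + 1) * c ^ 2 - delta k * (l ^ 2 + a)) /\
    ((forall l, L l -> c ^ 2 - delta k * (l ^ 2 + a) <> 0) ->
     exists (psi0 : R) (Psi : R -> R),
       is_Psi k a c psi0 L Psi /\
       profile_classification k a c L Psi (reparam p U)).
Proof.
pose proof (rs_interval _ _ _ _ Hsurf) as HJ.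
destruct Hparam as [hlam [hU hder]].
assert (hd : forall t, J t -> ex_derive lam t) by (intros t ht; apply hder, ht).
assert (hpos : forall t, J t -> 0 < lam t ^ 2 + a).
{ intros t ht; apply Hpos, hlam, ht. }
destruct (radius_lam_conserved k J p N kap lam a Hsurf HN Hcurv Hweingarten hd hpos)
  as [c [hc hcons]].
set (rho := radius k p) in *.
set (drho := radius k (Dprofile p)) in *.
set (W := swirl k p (Dprofile p)).
assert (dl : forall u, J u -> is_derive lam u
    (- ((lam u ^ 2 + a) * drho u) / (lam u * rho u))).
{ intros u hu; exact (is_derive_lam k J p N kap lam a u Hsurf HN Hcurv Hweingarten hd hu). }
assert (hr : forall u, J u -> 0 < rho u) by exact (rs_radius _ _ _ _ Hsurf).
assert (hl0 : forall u, J u -> lam u <> 0) by (intros; apply Hweingarten; auto).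
(* A critical point of the radius would be a critical point of [lam], which a regular change of
   parameter excludes. *)
assert (hdr0 : forall u, J u -> drho u <> 0).
{ intros u hu h0; apply (proj2 (hder u hu)).
  rewrite (is_derive_unique _ _ _ (dl u hu)), h0; field.
  split; [apply Rgt_not_eq, hr, hu|apply hl0, hu]. }
assert (hdr : forall u, J u -> drho u ^ 2 = (1 + lam u ^ 2) * rho u ^ 2 - delta k).
{ intros u hu; exact (proj1 (radius_equations k J p N kap lam u Hsurf HN Hcurv hu)). }
assert (hW : forall u, J u -> W u ^ 2 = drho u ^ 2 - rho u ^ 2 + delta k).
{ intros u hu; exact (swirl_sq k J p u Hsurf hu). }
assert (hrU : forall l, L l -> radius k (reparam p U) l = rho (U l))
  by (intros l _; unfold rho; destruct k; reflexivity).
assert (hsq : forall u, J u -> rho u ^ 2 * (lam u ^ 2 + a) = c ^ 2).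
{ intros u hu; rewrite <- (hcons u hu), Rpow_mult_distr, pow2_sqrt; auto.
  apply Rlt_le, hpos, hu. }
assert (hrl : forall l, L l -> radius k (reparam p U) l = c / sqrt (l ^ 2 + a)).
{ intros l hl; destruct (hU l hl) as [hj e]; rewrite hrU by auto.
  rewrite <- (hcons _ hj), e; field.
  apply Rgt_not_eq, sqrt_lt_R0, Hpos, hl. }
(* The radicand equals (l^2 + a) rho'^2. *)
assert (hD : forall l, L l -> 0 < (l ^ 2 + 1) * c ^ 2 - delta k * (l ^ 2 + a)).
{ intros l hl; destruct (hU l hl) as [hj e].
  rewrite <- (hsq _ hj), e.
  replace (_ - _) with ((l ^ 2 + a) * drho (U l) ^ 2)
    by (rewrite hdr by auto; rewrite e; ring).
  apply Rmult_lt_0_compat; [auto|]; apply pow2_gt_0; auto. }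
exists c; split; [auto|split; [auto|]]; intros hn.
assert (dU : forall l, L l ->
  is_derive U l (/ (- ((lam (U l) ^ 2 + a) * drho (U l)) / (lam (U l) * rho (U l))))).
{ intros l hl.
  apply (is_derive_inverse J L lam
    (fun u => - ((lam u ^ 2 + a) * drho u) / (lam u * rho u))); auto.
  - intros u hu; destruct (is_derive_coords k J p u Hsurf hu) as [[d1 _] [d2 _]].
    apply (ex_derive_continuous
      (fun u => - ((lam u ^ 2 + a) * drho u) / (lam u * rho u))).
    auto_derive; repeat split; auto; try (eexists; eassumption).
    apply Rmult_integral_contrapositive_currified; [auto|].
    apply Rgt_not_eq, hr, hu.
  - intros u hu; rewrite <- (is_derive_unique _ _ _ (dl u hu)); apply hder, hu. }
assert (hW0 : forall u, J u -> W u <> 0).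
{ intros u hu h0; pose proof (hW u hu) as h; rewrite h0, (hdr u hu) in h.
  assert (0 < (lam u * rho u) ^ 2); [|lra].
  apply pow2_gt_0, Rmult_integral_contrapositive_currified; [auto|].
  apply Rgt_not_eq, hr, hu. }
(* None of the three factors vanishes, [W] because W^2 = (lambda rho)^2. The resulting [s] settles
   the sign in front of the integral on all of [L]. *)
destruct (nonvanishing_sign J (fun u => W u * drho u * lam u)) as [s [hs hsT]]; auto.
{ intros u hu.
  destruct (is_derive_coords k J p u Hsurf hu) as [[d1 [d2 d3]] [d4 [d5 d6]]].
  apply (ex_derive_continuous (fun u => W u * drho u * lam u)).
  assert (dW : ex_derive W u).
  { unfold W, swirl; destruct k; simpl in d1, d2, d3, d4, d5, d6; simpl;
      auto_derive; repeat split; auto; eexists; eassumption. }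
  auto_derive; repeat split; auto; eexists; eassumption. }
{ intros u hu; repeat apply Rmult_integral_contrapositive_currified; auto. }
(* Each family now only has to supply an angle in u with rate W / (rho^2 - delta). The chain rule
   with [U] gives the integrand; the sign is [- s] since lambda' carries a minus. *)
assert (hPsi : forall Phi : R -> R,
  (forall u, J u -> is_derive Phi u (W u / (rho u ^ 2 - delta k))) ->
  is_Psi k a c 0 L (fun l => Phi (U l))).
{ intros Phi hPhi; apply (is_Psi_of_derive k a c (- s)); auto.
  { destruct hs; subst s; [right|left]; ring. }
  intros l hl; destruct (hU l hl) as [hj e].
  evar_last; [apply (is_derive_comp Phi U); [apply hPhi, hj|apply dU, hl]|].
  rewrite <- (Psi_rate k a c l (rho (U l)) (drho (U l)) (W (U l)) s); auto.
  - rewrite e; unfold scal; simpl; unfold mult; simpl; apply Rmult_comm.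
  - rewrite <- e; auto.
  - rewrite <- (hcons _ hj), e; auto.
  - rewrite hdr by auto; rewrite e; auto.
  - rewrite <- e at 3; apply hsT, hj. }
(* Here c^2 - delta (lambda^2 + a) factors as (lambda^2 + a) (rho^2 - delta). *)
assert (hn' : forall u, J u -> rho u ^ 2 - delta k <> 0).
{ intros u hu h0; apply (hn (lam u)); [apply hlam, hu|].
  rewrite <- (hsq u hu); replace (delta k) with (rho u ^ 2) by lra; ring. }
assert (hgram : forall u, J u -> g3 k (curve3 k p u) (curve3 k p u) = 1).
{ intros u hu; exact (proj1 (curve_gram k J p u Hsurf hu)). }
assert (hcoord : forall u, J u ->
  is_derive (coord2 k p) u (coord2 k (Dprofile p) u) /\
  is_derive (coord3 k p) u (coord3 k (Dprofile p) u)).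
{ intros u hu; exact (proj2 (proj1 (is_derive_coords k J p u Hsurf hu))). }
assert (hL : exists l, L l) by exact (open_interval_inhabited L HL).
exists 0; destruct k.
(* Since z^2 - w^2 = 1 - y^2, the constant sign of y^2 - 1 decides which of z and w carries the
   cosh. *)
- destruct (nonvanishing_sign J (fun u => rho u ^ 2 - 1)) as [t [ht hsgn]]; auto.
  { intros u hu; destruct (is_derive_coords _ J p u Hsurf hu) as [[d1 _] _].
    apply (ex_derive_continuous (fun u => rho u ^ 2 - 1)).
    auto_derive; eexists; eassumption. }
  assert (hz : forall u, J u -> is_derive (pz p) u (Derive (pz p) u))
    by (intros u hu; apply (hcoord u hu)).
  assert (hw : forall u, J u -> is_derive (pw p) u (Derive (pw p) u))
    by (intros u hu; apply (hcoord u hu)).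
  simpl in hgram; destruct ht; subst t.
  (* For y > 1 the coordinate w dominates, and the angle has rate (w z' - z w') / (y^2 - 1), which
     is the required one. *)
  + destruct (hyperbolic_angle J (pw p) (pz p) _ _ HJ hw hz) as [sg [F [hsg hF]]].
    { intros u hu; specialize (hsgn u hu); specialize (hgram u hu).
      unfold rho in hsgn; simpl in hsgn; lra. }
    assert (e : forall u, J u -> pw p u ^ 2 - pz p u ^ 2 = rho u ^ 2 - 1).
    { intros u hu; specialize (hgram u hu); unfold rho; simpl; lra. }
    exists (fun l => F (U l)); split; [apply hPsi|right; split].
    * intros u hu; destruct (hF u hu) as [_ [_ dF]]; rewrite e in dF by auto; exact dF.
    * exists sg; split; auto; intros l hl; destruct (hU l hl) as [hj _].
      destruct (hF _ hj) as [f1 [f2 _]]; rewrite e in f1, f2 by auto.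
      split; [exact (hrl l hl)|split]; assumption.
    * apply range_b_of_bounds; auto; intros l hl; split; auto.
      destruct (hU l hl) as [hj el]; specialize (hsgn _ hj).
      rewrite <- (hsq _ hj), el; specialize (Hpos l hl); nra.
  (* For y < 1 the roles of z and w are exchanged; numerator and denominator of the rate both change
     sign. *)
  + destruct (hyperbolic_angle J (pz p) (pw p) _ _ HJ hz hw) as [sg [F [hsg hF]]].
    { intros u hu; specialize (hsgn u hu); specialize (hgram u hu).
      unfold rho in hsgn; simpl in hsgn; lra. }
    assert (e : forall u, J u -> pz p u ^ 2 - pw p u ^ 2 = 1 - rho u ^ 2).
    { intros u hu; specialize (hgram u hu); unfold rho; simpl; lra. }
    exists (fun l => F (U l)); split; [apply hPsi|left; split].
    * intros u hu; destruct (hF u hu) as [_ [_ dF]]; rewrite e in dF by auto.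
      evar_last; [exact dF|]; specialize (hn' u hu); simpl in hn'.
      unfold W, delta; simpl; field; lra.
    * exists sg; split; auto; intros l hl; destruct (hU l hl) as [hj _].
      destruct (hF _ hj) as [f1 [f2 _]]; rewrite e in f1, f2 by auto.
      split; [exact (hrl l hl)|split]; assumption.
    * apply range_a_of_bounds; auto; intros l hl.
      destruct (hU l hl) as [hj el]; specialize (hsgn _ hj).
      specialize (hD l hl); simpl in hD; specialize (Hpos l hl).
      split; [rewrite <- el; auto|split; [auto|split; [|lra]]].
      rewrite <- (hsq _ hj), el; nra.
- simpl in hgram.
  assert (e : forall u, J u -> px p u ^ 2 + py p u ^ 2 = 1 + rho u ^ 2).
  { intros u hu; specialize (hgram u hu); unfold rho; simpl; lra. }
  (* Here x^2 + y^2 = 1 + w^2 is rho^2 - delta and never vanishes, so the polar angle of (x, y)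
     exists on all of [J]. *)
  destruct (circular_angle J (px p) (py p) (Derive (px p)) (Derive (py p)) HJ)
    as [F hF].
  { intros u hu; split; [apply (hcoord u hu)|].
    destruct (is_derive_coords _ J p u Hsurf hu) as [_ [_ [d _]]].
    apply (ex_derive_continuous (Derive (px p))); eexists; exact d. }
  { intros u hu; split; [apply (hcoord u hu)|].
    destruct (is_derive_coords _ J p u Hsurf hu) as [_ [_ [_ d]]].
    apply (ex_derive_continuous (Derive (py p))); eexists; exact d. }
  { intros u hu; rewrite e by auto; pose proof (pow2_ge_0 (rho u)); lra. }
  exists (fun l => F (U l)); split; [apply hPsi|split].
  + intros u hu; destruct (hF u hu) as [_ [_ dF]]; rewrite e in dF by auto.
    evar_last; [exact dF|]; unfold W; simpl; f_equal; ring.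
  + intros l hl; destruct (hU l hl) as [hj _].
    destruct (hF _ hj) as [f1 [f2 _]]; rewrite e in f1, f2 by auto.
    split; [exact (hrl l hl)|split]; assumption.
  + apply range_c_of_bounds, Hpos.
(* The affine angle is x / z, whose derivative (z x' - x z') / z^2 is W / rho^2; w then follows from
   2 z w + x^2 = 1. *)
- simpl in hgram; exists (fun l => px p (U l) / pz p (U l)); split; [|split].
  + apply (hPsi (fun u => px p u / pz p u)); intros u hu.
    pose proof (hr u hu) as hru.
    destruct (is_derive_coords _ J p u Hsurf hu) as [[d1 [d2 _]] _].
    evar_last; [apply (is_derive_div (px p) (pz p) u _ _ d2 d1)|].
    * apply Rgt_not_eq, hru.
    * unfold W, rho, delta in *; simpl in *; field; lra.
  + intros l hl; destruct (hU l hl) as [hj _].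
    pose proof (hr _ hj) as hru; unfold rho in hru; simpl in hru.
    split; [exact (hrl l hl)|simpl; split; [field; lra|]].
    specialize (hgram _ hj).
    apply (Rmult_eq_reg_r (2 * pz p (U l))); [|lra].
    field_simplify; [|lra]; lra.
  + apply range_c_of_bounds, Hpos.
Qed.
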